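(* Let $G$ be a simple graph, let $n$ be its number of vertices, and let $\bar G$ be its complement. Denote by $c(G)$ the number of directed Hamiltonian cycles in $G$. Then $$\mathcal L\left[\pi^+_{\bar G}(t)\right]=c(G)+(-1)^{n-1}c(\bar G).$$
   Context: Graphs are without loops or multiple edges. A $k$-path cover of a graph is a set of $k$ vertex-disjoint directed paths in the graph covering all vertices, including trivial paths consisting of a single vertex (so a $1$-path cover is a directed Hamiltonian path). Let $p_k(G)$ be the number of $k$-path covers of $G$. For a graph $G$ with $n$ vertices the signed path-cover polynomial is $\pi_G^+(t)=\sum_{k=1}^n(-1)^{n-k}p_k(G)t^k$. For a polynomial $f$ without constant term, $\mathcal L[f(t)]=\int_0^\infty f(t)\,d\mu(t)=\int_0^\infty t^{-1}e^{-t}f(t)\,dt$ is the Lebesgue–Stieltjes integral represented by the measure $d\mu(t)=t^{-1}e^{-t}dt$ on $[0,\infty)$.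
   Formalization: The one-vertex graph is excluded: for n = 1 the left side is L[t] = 1 while the right side is 2c(K_1), an even integer, so the identity fails there; all other n are covered (with c(K_2) = 1). *)

(* Defs.v *)
From HB Require Import structures.
From mathcomp Require Import all_boot all_order all_algebra.
From mathcomp Require Import all_classical all_reals all_analysis.
Set Implicit Arguments.
Unset Strict Implicit.
Unset Printing Implicit Defensive.
Import Order.TTheory GRing.Theory Num.Theory.
Import numFieldNormedType.Exports.
Local Open Scope classical_set_scope.
Local Open Scope ring_scope.

(* A simple graph on the finite vertex set V is an irreflexive symmetric
   relation e : rel V. *)
Definition compl_rel (V : finType) (e : rel V) : rel V :=
  [rel x y | (x != y) && ~~ e x y].

(* A directed path is the sequence of its vertices, in order; a sequence of
   distinct vertices has size at most #|V|, whence the finite type of bounded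
   sequences below. *)
Definition is_dipath (V : finType) (e : rel V) (s : seq V) : bool :=
  [&& s != [::], uniq s & sorted e s].

Definition is_path_cover (V : finType) (e : rel V) (k : nat)
    (P : {set {bseq #|V| of V}}) : bool :=
  [&& #|P| == k,
      [forall s in P, is_dipath e s],
      [forall s in P, forall s' in P, forall x : V,
         (x \in s) && (x \in s') ==> (s == s')]
    & [forall x : V, exists s in P, x \in s]].

Definition npath_covers (V : finType) (e : rel V) (k : nat) : nat :=
  #|[set P : {set {bseq #|V| of V}} | is_path_cover e k P]%SET|.

Definition path_cover_poly (R : realType) (V : finType) (e : rel V) :
    {poly R} :=
  \sum_(1 <= k < #|V|.+1)
    ((-1) ^+ (#|V| - k) * (npath_covers e k)%:R) *: 'X^k.

Definition arcs (V : finType) (c : seq V) : {set V * V} :=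
  [set a | (a.1 \in c) && (a.2 == next c a.1)]%SET.

(* A directed Hamiltonian cycle is identified with its set of arcs, so that
   the rotations of a cyclic enumeration of V are counted once, while the two
   orientations of a cycle of length at least 3 are distinct.
   In particular the complete graph on 2 vertices has exactly one. *)
Definition nham_cycles (V : finType) (e : rel V) : nat :=
  #|[set arcs c | c : #|V|.-tuple V & ucycleb e c]%SET|.

(* The integrand is (junk) 0 at t = 0, which is a Lebesgue-null point. *)
Definition Lint (R : realType) (f : {poly R}) : \bar R :=
  (\int[@lebesgue_measure R]_(t in `[0%R, +oo[)
     (t^-1 * expR (- t) * f.[t])%:E)%E.

(* Main.v *)
(* Let n = #|V|.  Averaging over rotations, (k - 1)! p_k(e) counts the pairs of
   a Hamiltonian cycle of the complete graph and a set of k of its arcs whose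
   removal leaves a k-path cover: cutting the cycle there leaves k cyclically
   ordered paths.  In terms of generating functions, put
     C(X) = \sum_w \prod_(x : V) (X + [e x (next w x)]),
   w ranging over the linear orders of V; then n (k - 1)! p_k is the coefficient
   of X^k in C.  This follows from X C'(X) = n \sum_k k! p_k X^k:
   differentiating cuts the cycle at one arc, and expanding the product over the
   other arcs yields the ordered path covers.
   Since L[X^k] = (k - 1)!, for C taken for the complement of e,
     n L[pi] = \sum_(k >= 1) (-1)^(n - k) C_k = (-1)^n (C(-1) - C(0)).
   Up to the factor n of rotations, C(0) counts the Hamiltonian cycles of the
   complement and (-1)^n C(-1) those of e. *)
Require Import Defs.
From HB Require Import structures.
From mathcomp Require Import all_boot all_order all_algebra.
From mathcomp Require Import all_classical all_reals all_analysis.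
From mathcomp Require Import measurable_realfun ring.
Import Order.TTheory GRing.Theory Num.Theory.
Local Open Scope ring_scope.

(** * Cutting a word into consecutive walks *)

Section Cuts.
Variables (T : eqType) (e : rel T).
Implicit Types (x y : T) (s w : seq T) (t : seq (seq T)).

Definition is_walk s := (s != [::]) && sorted e s.
Arguments is_walk : simpl never.

Definition extend_head x t : option (seq (seq T)) :=
  if t is (y :: s) :: t' then
    if e x y then Some ((x :: y :: s) :: t') else None
  else None.

(** Recursion on the word decides at each adjacent pair between cutting and joining, so that the
    generating function by number of pieces factors in [sum_cuts]. *)
Fixpoint cuts w : seq (seq (seq T)) :=
  if w is x :: w' then
    map (cons [:: x]) (cuts w') ++ pmap (extend_head x) (cuts w')
  else [:: [::]].

Lemma mem_cuts w t : (t \in cuts w) = all is_walk t && (flatten t == w).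
Proof.
elim: w t => [|x w IHw] t /=.
  rewrite inE; case: t => [|s t] //=; rewrite -size_eq0 size_cat addn_eq0.
  by rewrite size_eq0 /is_walk; case: (s == [::]); rewrite ?andbF.
rewrite mem_cat mem_pmap; apply/orP/andP => [[/mapP|/mapP]|].
- move=> [t' + ->]; rewrite IHw => /andP[wt' /eqP <-] /=.
  by rewrite wt' eqxx.
- move=> [[|[|y s] t'] //=]; rewrite IHw /= => /andP[/andP[ws wt'] /eqP <-].
  case: ifP => // exy [->]; split; last by rewrite /= eqxx.
  by rewrite /= wt' andbT /is_walk /= exy.
case: t => [[]//|s t] [/= /andP[ws wt]].
case: s ws => [|x' [|y s]] //= ws /eqP[xx' tw]; rewrite {}xx' in ws *.
  by left; rewrite map_f// IHw wt -tw eqxx.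
move: ws; rewrite /is_walk/= => /andP[exy ws]; right; apply/mapP.
exists ((y :: s) :: t); last by rewrite /= exy.
by rewrite IHw /= wt /is_walk /= ws -tw eqxx.
Qed.

Lemma cuts_uniq w : uniq (cuts w).
Proof.
elim: w => //= x w IHw; rewrite cat_uniq map_inj_uniq ?IHw => [|t t' []//].
(* The given function strips the first letter and so undoes [extend_head x]. The two halves are
   disjoint because the first walk is [[:: x]] in one and longer in the other. *)
rewrite (@pmap_uniq _ _ _ (fun t => behead (head [::] t) :: behead t))//=.
  rewrite andbT; apply/hasPn => t; rewrite mem_pmap => /mapP[t' _ tE].
  apply/mapP => -[t'' _ tE']; move: tE; rewrite {}tE'.
  by case: t' => [|[|y s] t'] //=; case: ifP.
by move=> [|[|y s] t] //=; case: ifP.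
Qed.

(** An adjacent pair is either cut, which opens a new walk and costs ['X], or kept, which requires
    an arc. The leading ['X] counts the first walk. *)
Lemma sum_cuts (R : comNzRingType) x s :
  \sum_(t <- cuts (x :: s)) 'X^(size t) =
    'X * \prod_(a <- zip (belast x s) s) ('X + (e a.1 a.2)%:R) :> {poly R}.
Proof.
elim: s x => [|y s IHs] x.
  by rewrite /= big_seq1 big_nil expr1 mulr1.
rewrite [belast _ _]/= [zip _ _]/= big_cons mulrCA -IHs mulrDl !mulr_sumr.
rewrite [cuts _]/= -/(cuts (y :: s)) big_cat big_map big_pmap; congr +%R.
  by apply: eq_bigr => t _; rewrite /= exprS.
rewrite big_seq [RHS]big_seq; apply: eq_bigr => t.
rewrite mem_cuts => /andP[wt /eqP].
case: t wt => [|[|y' s'] t] //= _ [-> _].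
by case: (e x y); rewrite /= ?mul1r ?mul0r.
Qed.

End Cuts.
Arguments is_walk {T} e s : simpl never.
Arguments cuts {T} e w.

(** * Disjoint sequences, successors in a cycle, and the Leibniz rule *)

(** Empty entries must be excluded: repeating them leaves [flatten t] duplicate-free. *)
Lemma uniq_flattenP (T : eqType) (t : seq (seq T)) : [::] \notin t ->
  reflect [/\ uniq t, {in t, forall s, uniq s} &
     {in t &, forall s s' x, x \in s -> x \in s' -> s = s'}]
  (uniq (flatten t)).
Proof.
elim: t => [|s t IHt]; first by left; split.
rewrite inE negb_or eq_sym => /andP[s0 t0] /=; rewrite cat_uniq.
apply: (iffP and3P) => [[Us st /(IHt t0) [Ut Ust inj_t]]|].
  have st' s' x : s' \in t -> x \in s -> x \in s' -> False.
    move=> s't xs xs'.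
    have /(hasPn st)/negP[//] : x \in flatten t by apply/flattenP; exists s'.
  split.
  - rewrite Ut andbT; apply/negP => /st'.
    by case: (s) s0 => // x s1 _ /(_ x); rewrite mem_head; apply.
  - by move=> s'; rewrite inE => /predU1P[->|/Ust].
  move=> s1 s2; rewrite !inE => /predU1P[->|s1t] /predU1P[->|s2t] x //.
  - by move=> xs /st'-/(_ s2t).
  - by move=> + /st'-/(_ _ s1t).
  - exact: inj_t.
move=> [/andP[sNt Ut] Ust inj_t]; split.
- by apply: Ust; rewrite mem_head.
- apply/hasPn => x /flattenP[s' s't xs']; apply: contra sNt => xs.
  by rewrite (inj_t s s' _ _ x)// ?mem_head// inE s't orbT.
- apply/(IHt t0); split => // [s' s't|s1 s2 s1t s2t].
    by apply: Ust; rewrite inE s't orbT.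
  by apply: inj_t; rewrite inE ?s1t ?s2t orbT.
Qed.

Lemma next_belast (T : eqType) (x : T) (s : seq T) : uniq (x :: s) ->
  map (next (x :: s)) (belast x s) = s.
Proof.
move=> Us; apply: (@eq_from_nth _ x); rewrite size_map size_belast// => i ltis.
rewrite (nth_map x) ?size_belast//.
have -> : nth x (belast x s) i = nth x (x :: s) i.
  by rewrite lastI nth_rcons size_belast ltis.
have ltis' : (i < size (x :: s))%N by rewrite ltnS ltnW.
by rewrite next_nth mem_nth// index_uniq//; apply: set_nth_default.
Qed.

Lemma deriv_prod (R : comNzRingType) (I : finType) (f : I -> {poly R}) :
  (\prod_i f i)^`() = \sum_i (f i)^`() * \prod_(j | j != i) f j.
Proof.
(* The induction runs over an arbitrary duplicate-free list in place of the enumeration of [I]. *)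
elim: (index_enum I) (index_enum_uniq I) => [|i r IHr] /=.
  by rewrite !big_nil derivC.
move=> /andP[ir Ur]; rewrite !big_cons derivM eqxx IHr//.
congr (_ * _ + _).
  rewrite big_seq [RHS]big_seq_cond; apply: eq_bigl => j.
  by case: (boolP (j \in r)) => // jr; apply/esym; apply: contraNneq ir => <-.
rewrite mulr_sumr big_seq [RHS]big_seq; apply: eq_bigr => j jr.
have ij : i != j by apply: contraNneq ir => ->.
by rewrite big_cons ij mulrCA.
Qed.

Lemma uniq_full (V : finType) (s : seq V) :
  uniq s -> size s = #|V| -> forall x, x \in s.
Proof.
move=> Us sz x; suff /subset_cardP : #|s| = #|V|.
  by move/(_ (subset_predT _)) => ->.
by rewrite (card_uniqP Us).
Qed.

(** * Ordered path covers and their enumeration *)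

Definition ordered_cover (V : finType) (e : rel V) k
    (t : k.-tuple {bseq #|V| of V}) : bool :=
  let u := [seq val s | s <- t] in
  [&& all (is_walk e) u, uniq (flatten u) & size (flatten u) == #|V|].
Arguments ordered_cover {V} e {k} t.

(** A duplicate-free concatenation of length [#|V|] expresses disjointness and covering at once;
    since the walks are nonempty, it also forces them to be pairwise distinct. *)
Lemma ordered_coverE (V : finType) (e : rel V) k
    (t : k.-tuple {bseq #|V| of V}) :
  ordered_cover e t = uniq t && is_path_cover e k [set s in t]%SET.
Proof.
rewrite /ordered_cover; set u := map _ _.
have u0 : all (is_walk e) u -> [::] \notin u.
  by move=> /allP wu; apply/negP => /wu.
have ut : uniq u = uniq t by rewrite map_inj_uniq//; exact: val_inj.
apply/and3P/andP => [[wu Uf /eqP sf]|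
    [Ut /and4P[_ /forall_inP dp /forall_inP dj /forallP cv]]].
  have /(uniq_flattenP _ _ (u0 wu))[Uu Us inj_u] := Uf.
  have Ut : uniq t by rewrite -ut.
  split=> //; apply/and4P; split.
  - by rewrite cardsE (card_uniqP Ut) size_tuple.
  - apply/forall_inP => s; rewrite inE => st.
    have su : val s \in u by rewrite map_f.
    by rewrite /is_dipath Us// andbCA /= -/(is_walk _ _) (allP wu).
  - apply/forall_inP => s; rewrite inE => st.
    apply/forall_inP => s'; rewrite inE => s't.
    apply/forallP => x; apply/implyP => /andP[xs xs'].
    by apply/eqP/val_inj; apply: (inj_u _ _ _ _ x); rewrite ?map_f.
  - apply/forallP => x.
    have /flattenP[_ /mapP[s st ->] xs] := uniq_full _ _ Uf sf x.
    by apply/exists_inP; exists s; rewrite ?inE.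
have {}dp s : s \in u -> is_dipath e s.
  by move=> /mapP[s' s't ->]; apply: dp; rewrite inE.
have wu : all (is_walk e) u.
  by apply/allP => s /dp; rewrite /is_dipath andbCA => /andP[].
have Uf : uniq (flatten u).
  apply/(uniq_flattenP _ _ (u0 wu)); split; first by rewrite ut.
    by move=> s /dp; rewrite /is_dipath andbCA => /andP[].
  move=> _ _ /mapP[s st ->] /mapP[s' s't ->] x xs xs'.
  have := dj s; rewrite inE => /(_ st)/forall_inP/(_ s').
  by rewrite inE => /(_ s't)/forallP/(_ x); rewrite xs xs' => /eqP ->.
split=> //; rewrite -(card_uniqP Uf); apply/eqP/eq_card => x.
have /exists_inP[s] := cv x; rewrite !inE => st xs.
by apply/flattenP; exists (val s); rewrite ?map_f.
Qed.

(** The fibre over a cover [P] of the map forgetting the order consists of the duplicate-free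
    [k]-tuples from [P], with [#|P| = k]. *)
Lemma card_ordered_cover (V : finType) (e : rel V) k :
  #|[pred t : k.-tuple {bseq #|V| of V} | ordered_cover e t]| =
    (npath_covers e k * k`!)%N.
Proof.
rewrite -sum1_card (partition_big (fun t : k.-tuple _ => [set s in t]%SET)
  (fun P => is_path_cover e k P)) => [|t]; last first.
  by rewrite inE ordered_coverE => /andP[].
rewrite /npath_covers -sum_nat_const big_set; apply: eq_bigr => P cP.
have /eqP cardP : #|P| == k by case/and4P: cP.
transitivity (#|P| ^_ k)%N; last by rewrite cardP ffactnn.
rewrite -card_uniq_tuples -sum1_card; apply: eq_bigl => t.
rewrite !inE ordered_coverE.
apply/idP/idP => [/andP[/andP[-> _] /eqP <-]|/andP[/allP tP Ut]].
  rewrite andbT; apply/allP => s st.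
  by have : s \in [set s in t]%SET by rewrite inE.
have -> : [set s in t]%SET = P; last by rewrite Ut cP; apply/eqP.
apply/eqP; rewrite eqEcard; apply/andP; split.
  by apply/fintype.subsetP => s; rewrite inE => /tP.
by rewrite cardP cardsE (card_uniqP Ut) size_tuple.
Qed.

Lemma card_walk_tuples (V : finType) (e : rel V) k (w : seq V) :
  size w = #|V| ->
  #|[pred t : k.-tuple {bseq #|V| of V} |
     all (is_walk e) [seq val s | s <- t] &&
     (flatten [seq val s | s <- t] == w)]| =
  count (fun t => size t == k) (cuts e w).
Proof.
move=> szw; set P := [pred t | _].
rewrite -size_filter cardE.
pose f (t : k.-tuple {bseq #|V| of V}) := [seq val s | s <- t].
rewrite -(size_map f); apply: perm_size; apply: uniq_perm.
- rewrite map_inj_uniq ?enum_uniq// => t t'.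
  by move/(inj_map val_inj)/val_inj.
- by rewrite filter_uniq// cuts_uniq.
move=> u; rewrite mem_filter mem_cuts.
apply/mapP/and3P => [[t]|[/eqP szu wu /eqP uw]].
  by rewrite mem_enum => /andP[wt tw] ->; rewrite size_map size_tuple.
have usz s : s \in u -> (size s <= #|V|)%N.
  move=> /(perm_to_rem)/perm_flatten/perm_size.
  by rewrite uw szw /= size_cat => ->; rewrite leq_addr.
(* The default [[bseq]] is never taken on [u]: by [usz], every piece of [w] fits the bound. *)
pose g s : {bseq #|V| of V} := insubd [bseq] s.
have gK : map val (map g u) = u.
  rewrite -map_comp -[RHS]map_id; apply/eq_in_map => s /usz ssz.
  by rewrite /= insubdK.
exists (tcast szu (map_tuple g (in_tuple u))).
  by rewrite mem_enum inE val_tcast/= gK wu uw eqxx.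
by rewrite /f val_tcast/= gK.
Qed.

(** Double counting: concatenating an ordered cover gives a linear order [w] of the vertices, of
    which the cover is a cut. *)
Lemma npath_covers_fact (V : finType) (e : rel V) k :
  (npath_covers e k * k`!)%N =
  (\sum_(w : #|V|.-tuple V | uniq w)
     count (fun t => size t == k) (cuts e w))%N.
Proof.
rewrite -card_ordered_cover -sum1_card.
under [RHS]eq_bigr => w _ do
  rewrite -card_walk_tuples ?size_tuple// -sum1_card.
rewrite (exchange_big_dep (fun t => ordered_cover e t))/=.
  apply: eq_bigr => t /and3P[wt Uf szf].
  rewrite (big_pred1 (Tuple szf))// => w.
  rewrite inE wt /= -val_eqE /= eq_sym.
  by case: eqP => [->|_]; rewrite ?Uf ?andbF.
move=> w t Uw /andP[wt /eqP tw].
by rewrite /ordered_cover wt tw Uw size_tuple eqxx.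
Qed.

(** * Rotations of linear orders and Hamiltonian cycles *)

Lemma perm_index_enum (V : finType) (s : seq V) :
  uniq s -> size s = #|V| -> perm_eq (index_enum V) s.
Proof.
move=> Us szs; apply: uniq_perm => [||x]; rewrite ?index_enum_uniq//.
by rewrite mem_index_enum uniq_full.
Qed.

(** Summing over a marked vertex is summing over its position [j]. Rotating by [j] brings it to the
    front without changing [F], so all positions contribute equally. *)
Lemma sum_uniq_tuples_rot (A : nmodType) (V : finType) (x0 : V)
    (F : seq V -> V -> A) (i : nat) :
  (forall w j x, uniq w -> F (rot j w) x = F w x) -> (i < #|V|)%N ->
  \sum_(w : #|V|.-tuple V | uniq w) \sum_x F w x =
    (\sum_(w : #|V|.-tuple V | uniq w) F w (nth x0 w i)) *+ #|V|.
Proof.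
move=> Frot lti; pose S j := \sum_(w : #|V|.-tuple V | uniq w) F w (nth x0 w j).
have S0 j : (j < #|V|)%N -> S j = S 0.
  pose h (w : #|V|.-tuple V) := [tuple of rot j w].
  move=> ltj; rewrite /S [RHS](reindex_inj (h := h)).
    apply: eq_big => [w|w Uw]; first by rewrite rot_uniq.
    rewrite Frot// /rot nth_cat size_drop size_tuple subn_gt0 ltj.
    by rewrite nth_drop addn0.
  by move=> w w' /(congr1 val)/rot_inj/val_inj.
transitivity (\sum_(0 <= j < #|V|) S j).
  rewrite [RHS]exchange_big; apply: eq_bigr => w Uw /=.
  rewrite (perm_big w) => [|/=]; first by rewrite (big_nth x0) size_tuple.
  by rewrite perm_index_enum ?size_tuple.
rewrite big_nat; under eq_bigr => j /S0 -> do rewrite -(S0 i lti).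
by rewrite -big_nat sumr_const_nat subn0.
Qed.

Lemma cycle_nextE (V : finType) (e : rel V) (w : seq V) :
  uniq w -> size w = #|V| -> cycle e w = [forall x, e x (next w x)].
Proof.
move=> Uw szw; apply/idP/forallP => [cw x|ew].
  by apply: next_cycle => //; exact: uniq_full.
by apply: sub_cycle (cycle_next Uw) => x _ /eqP <-.
Qed.

Lemma next_neq (T : eqType) (w : seq T) (x : T) :
  uniq w -> (1 < size w)%N -> x \in w -> next w x != x.
Proof.
move=> Uw szw /rot_to[i s ws].
rewrite -(next_rot i Uw) ws.
have : uniq (x :: s) by rewrite -ws rot_uniq.
have : (1 < size (x :: s))%N by rewrite -ws size_rot.
case: s {ws} => [//|y s] _ /=; rewrite eqxx inE negb_or eq_sym.
by move=> /andP[/andP[]].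
Qed.

Lemma arcs_rot (V : finType) (i : nat) (c : seq V) :
  uniq c -> arcs (rot i c) = arcs c.
Proof. by move=> Uc; apply/setP=> a; rewrite !inE mem_rot next_rot. Qed.

(** As [x] is also the default of [nth], the first hypothesis allows an empty [s]. *)
Lemma fcycle_traject (T : eqType) (f : T -> T) (x : T) (s : seq T) :
  nth x s 0 = x -> fcycle f s -> s = traject f x (size s).
Proof.
case: s => [|y s]//= ->; rewrite rcons_path => /andP[/fpathE + _].
by move=> {1}->.
Qed.

(** All vertices occur in [c], so its arcs determine [next c]; the orbit of [x0] under this map is
    [c] itself. *)
Lemma arcs_inj (V : finType) (x0 : V) (c c' : #|V|.-tuple V) :
  uniq c -> uniq c' -> nth x0 c 0 = x0 -> nth x0 c' 0 = x0 ->
  arcs c = arcs c' -> c = c'.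
Proof.
move=> Uc Uc' c0 c'0 /setP arcsE.
have nextE : next c =1 next c'.
  move=> x; have := arcsE (x, next c x).
  by rewrite !inE/= !uniq_full ?size_tuple// eqxx => /esym/eqP.
apply: val_inj => /=; rewrite (fcycle_traject _ _ _ _ c0 (cycle_next Uc)).
rewrite [RHS](fcycle_traject _ (next c) _ _ c'0) ?size_tuple//.
by rewrite (eq_fcycle nextE) cycle_next.
Qed.

Lemma natr_nham_cycles (R : nzRingType) (V : finType) (x0 : V) (e : rel V) :
  (nham_cycles e * #|V|)%:R =
  \sum_(w : #|V|.-tuple V | uniq w) (cycle e w)%:R :> R.
Proof.
(* Summed over [x], [F w x] is the cycle indicator; at position [0] it selects the orders starting
   at [x0], which represent each cycle once. *)
pose F (w : seq V) x : R := if x == x0 then (cycle e w)%:R else 0.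
have Vgt0 : (0 < #|V|)%N by apply/card_gt0P; exists x0.
transitivity (\sum_(w : #|V|.-tuple V | uniq w) \sum_x F w x); last first.
  by apply: eq_bigr => w _; rewrite -big_mkcond big_pred1_eq.
rewrite (sum_uniq_tuples_rot _ _ x0 F 0)//; last first.
  by move=> w j x Uw; rewrite /F rot_cycle.
rewrite natrM mulr_natr; congr (_ *+ _).
rewrite -big_mkcondr/=.
pose D := [set c : #|V|.-tuple V | ucycleb e c && (nth x0 c 0 == x0)]%SET.
have -> : nham_cycles e = #|D|.
  pose f (c : #|V|.-tuple V) := arcs c.
  rewrite /nham_cycles -(card_in_imset (f := f) (D := D)).
    apply: eq_card => a; apply/imsetP/imsetP => [] [c]; rewrite !inE.
      move=> /andP[cc Uc] ->.
      have x0c : x0 \in (c : seq V) by rewrite uniq_full ?size_tuple.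
      exists [tuple of rot (index x0 c) c]; last by rewrite /f arcs_rot.
      rewrite inE /ucycleb rot_uniq rot_cycle cc Uc /=.
      rewrite /rot nth_cat size_drop subn_gt0 index_mem x0c nth_drop addn0.
      by rewrite nth_index.
    by move=> /andP[cc _] ->; exists c; rewrite ?inE.
  move=> c c'; rewrite !inE.
  move=> /andP[/andP[_ Uc] /eqP c0] /andP[/andP[_ Uc'] /eqP c'0].
  exact: (arcs_inj V x0).
under eq_bigr do rewrite mulrb.
rewrite -big_mkcondr -sum1_card natr_sum; apply: eq_bigl => c.
by rewrite !inE /ucycleb andbC [cycle _ _ && _]andbC andbCA andbA.
Qed.

(** * The polynomial [C]: its coefficients and special values *)

Definition cyc_poly (R : comNzRingType) (V : finType) (e : rel V) : {poly R} :=
  \sum_(w : #|V|.-tuple V | uniq w) \prod_x ('X + (e x (next w x))%:R).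
Arguments cyc_poly R {V} e.

Lemma prod_natr_bool (R : comNzRingType) (I : finType) (b : pred I) :
  \prod_i (b i)%:R = [forall i, b i]%:R :> R.
Proof.
case: forallP => [bT|bF]; first by rewrite big1// => i _; rewrite bT.
have /existsP[i /negbTE bi] : [exists i, ~~ b i].
  by rewrite -negb_forall; apply/negP => /forallP.
by rewrite (bigD1 i)//= bi mul0r.
Qed.

(** Leaving out the last vertex drops exactly the arc that closes the cycle. *)
Lemma prod_neq_last (R : comNzRingType) (V : finType) (x : V) (s : seq V)
    (g : V -> V -> R) :
  uniq (x :: s) -> size (x :: s) = #|V| ->
  \prod_(y | y != last x s) g y (next (x :: s) y) =
    \prod_(a <- zip (belast x s) s) g a.1 a.2.
Proof.
move=> Us szs.
have -> : zip (belast x s) s = [seq (y, next (x :: s) y) | y <- belast x s].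
  by rewrite -[s in zip _ s](next_belast _ _ _ Us) -zip_map map_id.
rewrite big_map (perm_big _ (perm_index_enum _ _ Us szs)).
rewrite [X in \big[_/_]_(_ <- X | _) _]lastI big_rcons /= eqxx mulr1.
rewrite big_seq_cond [RHS]big_seq; apply: eq_bigl => y.
case: (boolP (y \in belast x s)) => //= yb.
move: Us; rewrite lastI rcons_uniq => /andP[+ _].
by apply: contraNneq => <-.
Qed.

Section CycPoly.
Variables (R : comNzRingType) (V : finType) (e : rel V).

Lemma cyc_poly_coef0 (x0 : V) : (cyc_poly R e)`_0 = (nham_cycles e * #|V|)%:R.
Proof.
rewrite (natr_nham_cycles _ _ x0) -horner_coef0 horner_sum.
apply: eq_bigr => w Uw; rewrite horner_prod cycle_nextE ?size_tuple//.
rewrite -prod_natr_bool; apply: eq_bigr => x _.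
by rewrite hornerD hornerX add0r -polyC_natr hornerC.
Qed.

(** With at least two vertices, [next w x] differs from [x], so the pair is an arc of exactly one of
    the two graphs: the factor at [-1] is [-1] for [e] and [0] for the complement. *)
Lemma cyc_poly_compl_N1 (x0 : V) : (1 < #|V|)%N ->
  (cyc_poly R (compl_rel e)).[-1] =
    (-1) ^+ #|V| * (nham_cycles e * #|V|)%:R.
Proof.
move=> V1; rewrite (natr_nham_cycles _ _ x0) horner_sum mulr_sumr.
apply: eq_bigr => w Uw; rewrite horner_prod cycle_nextE ?size_tuple//.
rewrite -prod_natr_bool -prodr_const -big_split /=; apply: eq_bigr => x _.
rewrite hornerD hornerX -polyC_natr hornerC /compl_rel/=.
rewrite eq_sym next_neq ?size_tuple ?uniq_full ?size_tuple//=.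
by case: (e _ _); rewrite ?addr0 ?mulr1 ?mulr0 ?addNr.
Qed.

Lemma size_cyc_poly : (size (cyc_poly R e) <= #|V|.+1)%N.
Proof.
apply: (leq_trans (size_sum _ _ _)); apply/bigmax_leqP => w _.
apply: (leq_trans (size_prod_leq _ _)).
under eq_bigr do rewrite -polyC_natr size_XaddC.
by rewrite sum_nat_const cardT -cardE muln2 -addnn subSn ?leq_addr// addnK.
Qed.

End CycPoly.

Lemma mulX_deriv_cyc_poly (R : comNzRingType) (V : finType) (e : rel V)
    (x0 : V) :
  'X * (cyc_poly R e)^`() =
  (\sum_(w : #|V|.-tuple V | uniq w) \sum_(t <- cuts e w) 'X^(size t)) *+ #|V|.
Proof.
pose F (w : seq V) x : {poly R} :=
  'X * \prod_(y | y != x) ('X + (e y (next w y))%:R).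
have Vgt0 : (0 < #|V|)%N by apply/card_gt0P; exists x0.
transitivity (\sum_(w : #|V|.-tuple V | uniq w) \sum_x F w x).
  rewrite /cyc_poly linear_sum /= mulr_sumr; apply: eq_bigr => w _.
  rewrite deriv_prod mulr_sumr; apply: eq_bigr => x _.
  by rewrite derivD derivX -polyC_natr derivC addr0 mul1r.
(* The vertex whose factor is differentiated is moved to the last position, so that the remaining
   factors are those of [sum_cuts]. *)
rewrite (sum_uniq_tuples_rot _ _ x0 F #|V|.-1) ?prednK//; last first.
  by move=> w j x Uw; rewrite /F; under eq_bigr do rewrite next_rot//.
congr (_ *+ _); apply: eq_bigr => w; have := size_tuple w.
case: (val w) => [sz|x s sz Us]; first by rewrite -sz in Vgt0.
rewrite sum_cuts /F -sz nth_last /=.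
by rewrite (prod_neq_last _ _ _ _ (fun y z => 'X + (e y z)%:R)).
Qed.

(** Comparing coefficients in [mulX_deriv_cyc_poly] gives the equation multiplied by [k.+1], which
    is cancelled in characteristic zero. *)
Lemma cyc_poly_coefS (R : numDomainType) (V : finType) (e : rel V) (x0 : V) k :
  (cyc_poly R e)`_k.+1 = (npath_covers e k.+1 * k`! * #|V|)%:R.
Proof.
have /(congr1 (fun p : {poly R} => p`_k.+1)) := mulX_deriv_cyc_poly R V e x0.
rewrite coefXM /= coef_deriv coefMn => E.
have k0 : k.+1%:R != 0 :> R by rewrite pnatr_eq0.
apply: (mulIf k0); rewrite mulr_natr {}E -natrM mulnAC -[(_ * k`! * _)%N]mulnA.
rewrite [(k`! * _)%N]mulnC -factS npath_covers_fact natrM mulr_natr.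
congr (_ *+ _).
rewrite coef_sum natr_sum; apply: eq_bigr => w _.
rewrite coef_sum -sum1_count natr_sum [RHS]big_mkcond /=; apply: eq_bigr => t _.
by rewrite coefXn eq_sym; case: eqP.
Qed.

(** * The functional [Lint] on polynomials *)

Section Integral.
Import numFieldNormedType.Exports.
Local Open Scope classical_set_scope.

Lemma cvgr_exprn_expRN (R : realType) (m : nat) :
  t ^+ m * expR (- t) @[t --> +oo%R] --> (0 : R).
Proof.
apply/cvgrPdist_le => e e0; near=> t.
have t0 : 0 < t by near: t; apply: nbhs_pinfty_gt; exact: num_real.
rewrite sub0r normrN ger0_norm; last first.
  by rewrite mulr_ge0 ?expR_ge0 ?exprn_ge0 ?ltW.
rewrite expRN ler_pdivrMr ?expR_gt0//.
(* One degree above [m] leaves a spare factor [t], which eventually exceeds the factorial of [m.+1]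
   divided by the tolerance. *)
have /(le_trans _) : 1 + t ^+ m.+1 / m.+1`!%:R <= expR t.
  by rewrite expR_ge1Dxn// ltW.
move=> h; rewrite mulrC -ler_pdivrMr//; apply: h.
apply: (@le_trans _ _ (t ^+ m.+1 / m.+1`!%:R)); last by rewrite lerDr.
rewrite exprSr -mulrA; apply: ler_wpM2l; first by rewrite exprn_ge0 ?ltW.
have f0 : 0 < m.+1`!%:R :> R by rewrite ltr0n fact_gt0.
rewrite (ler_pdivlMr _ _ f0).
by near: t; apply: nbhs_pinfty_ge; exact: num_real.
Unshelve. all: by end_near. Qed.

Lemma cvgr_horner_expRN (R : realType) (p : {poly R}) :
  p.[t] * expR (- t) @[t --> +oo%R] --> (0 : R).
Proof.
(* The extra power absorbs the factor ['X] in the induction step [p * 'X + c]. *)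
suff IH m : p.[t] * (t ^+ m * expR (- t)) @[t --> +oo%R] --> (0 : R).
  by have := IH 0; under eq_fun do rewrite expr0 mul1r.
elim/poly_ind: p m => [|p c IHp] m.
  by under eq_fun do rewrite horner0 mul0r; exact: cvg_cst.
under eq_fun do
  rewrite hornerMXaddC mulrDl -[_ * _ * (_ * _)]mulrA [X in _ * X]mulrA -exprS.
rewrite -(addr0 0); apply: cvgD; first exact: IHp.
rewrite -(mulr0 c); apply: cvgM; first exact: cvg_cst.
exact: cvgr_exprn_expRN.
Qed.

(* [q] is [\sum_(j <= m) m! / j! 'X^j], so that [- q.[t] * expR (- t)] is an
   antiderivative of [t ^+ m * expR (- t)]. *)
Lemma sub_deriv_polyXn (R : comNzRingType) (m : nat) :
  exists q : {poly R}, q - q^`() = 'X^m /\ q.[0] = m`!%:R.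
Proof.
elim: m => [|m [q [qE q0]]]; first by exists 1; rewrite derivC subr0 hornerC.
exists ('X^(m.+1) + q *+ m.+1); split.
  by rewrite derivD derivXn derivMn/= -qE mulrnBl subrK addrK.
by rewrite hornerD hornerXn hornerMn q0 expr0n add0r factS natrM mulr_natl.
Qed.

Lemma integral_exprn_expRN (R : realType) (m : nat) :
  (\int[@lebesgue_measure R]_(t in `[0%R, +oo[) (t ^+ m * expR (- t))%:E)%E
    = (m`!%:R)%:E.
Proof.
have [q [qE q0]] := sub_deriv_polyXn R m.
pose F (t : R) := - (q.[t] * expR (- t)).
have dF (t : R) : is_derive t 1 F (t ^+ m * expR (- t)).
  have -> : t ^+ m * expR (- t) =
     - (q.[t] *: (- expR (- t)) + expR (- t) *: q^`().[t]).
    rewrite -[t ^+ m]hornerXn -qE hornerD hornerN /GRing.scale/=.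
    by rewrite mulrN opprD opprK mulrBl [expR _ * _]mulrC.
  apply: is_deriveN; apply: is_deriveM.
  have -> : - expR (- t) = expR (- t) * - 1 by rewrite mulrN1.
  apply: (@is_derive1_comp _ expR -%R).
have cF : continuous F.
  by move=> t; apply/differentiable_continuous/derivable1_diffP; case: (dF t).
(* The two zeros are the left endpoint and the limit of [F] at infinity. *)
rewrite (@ge0_continuous_FTC2y R _ F 0 0).
- by rewrite sub0e /F q0 oppr0 expR0 mulr1 -EFinN opprK.
- by move=> x x0; rewrite mulr_ge0 ?expR_ge0 ?exprn_ge0.
- apply: continuous_subspaceT => x; apply: cvgM; first exact: exprn_continuous.
  by apply: continuous_comp; [exact: continuousN|exact: continuous_expR].
- by rewrite -oppr0; apply: cvgN; exact: cvgr_horner_expRN.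
- by move=> x _; case: (dF x).
- exact/cvg_at_right_filter/cF.
- by move=> x _; rewrite derive1E; case: (dF x).
Qed.

Lemma integrable_exprn_expRN (R : realType) (m : nat) :
  (@lebesgue_measure R).-integrable `[0%R, +oo[
    (fun t => (t ^+ m * expR (- t))%:E).
Proof.
apply/integrableP; split.
  apply/measurable_EFinP; apply: measurable_funTS.
  apply: continuous_measurable_fun => x.
  apply: cvgM; first exact: exprn_continuous.
  by apply: continuous_comp; [exact: continuousN|exact: continuous_expR].
under eq_integral => x.
  rewrite inE/= in_itv/= andbT => x0.
  rewrite ger0_norm ?mulr_ge0 ?expR_ge0 ?exprn_ge0//; over.
by rewrite integral_exprn_expRN ltry.
Qed.

Lemma integral_horner_expRN (R : realType) (n : nat) (p : {poly R}) :
  (size p <= n)%N ->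
  (\int[@lebesgue_measure R]_(t in `[0%R, +oo[) (p.[t] * expR (- t))%:E)%E
    = (\sum_(i < n) p`_i * i`!%:R)%:E.
Proof.
move=> szp.
under eq_integral => t _.
  rewrite (horner_coef_wide _ szp) mulr_suml -sumEFin.
  under eq_bigr do rewrite -mulrA EFinM.
  over.
rewrite integral_sum//=; last first.
  by move=> i; apply: integrableZl => //; exact: integrable_exprn_expRN.
rewrite -sumEFin; apply: eq_bigr => i _.
rewrite integralZl//; last exact: integrable_exprn_expRN.
by rewrite integral_exprn_expRN EFinM.
Qed.

Lemma Lint_mulX (R : realType) (n : nat) (p : {poly R}) :
  (size p <= n)%N ->
  Lint (p * 'X) = (\sum_(i < n) p`_i * i`!%:R)%:E.
Proof.
move=> szp.
rewrite -(integral_horner_expRN _ _ _ szp) /Lint.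
have mf : measurable_fun (`]0%R, +oo[ : set R)
    (fun t => (p.[t] * expR (- t))%:E).
  apply/measurable_EFinP; apply: measurable_funTS.
  apply: continuous_measurable_fun => x.
  apply: cvgM; first exact: continuous_horner.
  by apply: continuous_comp; [exact: opp_continuous|exact: continuous_expR].
have fE : {in `]0%R, +oo[%classic : set R, (fun t => (p.[t] * expR (- t))%:E) =1
    (fun t => (t^-1 * expR (- t) * (p * 'X).[t])%:E)}.
  move=> t; rewrite inE/= in_itv/= andbT => t0.
  by rewrite hornerMX [p.[t] * t]mulrC mulrACA mulVf ?gt_eqF// mul1r mulrC.
(* At [0] one integrand is [0] and the other [p.[0]], so both integrals pass to the open
   half-line. *)
rewrite -[LHS]integral_itv_obnd_cbnd; last exact: eq_measurable_fun mf.
rewrite -[RHS]integral_itv_obnd_cbnd//.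
by apply: eq_integral => t t0; rewrite fE.
Qed.

End Integral.

Theorem theorem3p4 (R : realType) (V : finType) (e : rel V)
    (e_sym : symmetric e) (e_irr : irreflexive e) (V_neq1 : #|V| <> 1%N) :
  Lint (path_cover_poly R (compl_rel e)) =
    ((nham_cycles e)%:R
     + (-1) ^ (#|V|%:Z - 1) * (nham_cycles (compl_rel e))%:R)%:E.
Proof.
set e' := compl_rel e.
(* The index is shifted by one to split off the factor ['X] that [Lint_mulX] expects. *)
pose a k : R := (-1) ^+ (#|V| - k.+1) * (npath_covers e' k.+1)%:R.
have -> : path_cover_poly R e' = \poly_(k < #|V|) a k * 'X.
  rewrite /path_cover_poly big_add1 /= big_mkord poly_def mulr_suml.
  by apply: eq_bigr => k _; rewrite -scalerAl -exprSr.
rewrite (Lint_mulX _ #|V|) ?size_poly//; congr EFin.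
under eq_bigr => k _ do rewrite coef_poly ltn_ord.
case: (posnP #|V|) => [V0|Vgt0].
  (* Without vertices the left side is an empty sum. The empty tuple is one Hamiltonian cycle of
     each graph and the exponent is [-1], so the right side is [1 - 1]. *)
  rewrite V0 big_ord0.
  have nham0 (f : rel V) : nham_cycles f = 1%N.
    apply/eqP/cards1P; exists (arcs [::]); apply/setP => A; rewrite inE.
    apply/imsetP/eqP => [[c _ ->]|->].
      by rewrite [tval c]size0nil// size_tuple.
    by exists (tcast (esym V0) [tuple]); rewrite ?inE val_tcast.
  by rewrite !nham0 mulr1 sub0r exprN1 invrN1 subrr.
(* On one vertex the identity fails: the left side is [1], while the only possible cycle is a loop,
   absent from both graphs. *)
have V1 : (1 < #|V|)%N by rewrite ltn_neqAle eq_sym; move/eqP: V_neq1 => ->.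
have /card_gt0P[x0 _] := Vgt0.
have nR0 : #|V|%:R != 0 :> R by rewrite pnatr_eq0 -lt0n.
apply: (mulIf nR0).
pose C := cyc_poly R e'.
have CE : C.[-1] = C`_0 + \sum_(k < #|V|) C`_k.+1 * (-1) ^+ k.+1.
  rewrite (horner_coef_wide _ (size_cyc_poly _ _ _)) big_ord_recl.
  by rewrite expr0 mulr1.
(* By [cyc_poly_coefS], the factorial weight and the factor [#|V|] turn each path count into a
   coefficient of [C]. *)
transitivity ((-1) ^+ #|V| * (C.[-1] - C`_0)).
  rewrite CE addrC addKr mulr_suml mulr_sumr; apply: eq_bigr => k _.
  rewrite (cyc_poly_coefS _ _ _ x0) !natrM /a.
  have -> : (-1) ^+ (#|V| - k.+1) = (-1) ^+ #|V| * (-1) ^+ k.+1 :> R.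
    by rewrite -exprD -signr_odd oddB// -oddD signr_odd.
  by ring.
rewrite cyc_poly_compl_N1// (cyc_poly_coef0 _ _ _ x0) !natrM.
have -> : (-1) ^ (#|V|%:Z - 1) = - (-1) ^+ #|V| :> R.
  by rewrite subzn// subn1 -[in RHS](prednK Vgt0) exprS mulN1r opprK.
by rewrite mulrBr signrMK mulrDl !mulNr mulrA.
Qed.
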